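(* The Rankmax mapping $$\hat p^{\mathrm{rm}}_i(s;y)=\frac{(s_i-s_y+1)_+}{\sum_{j=1}^C (s_j-s_y+1)_+},\qquad s\in\mathbb R^C,$$ where $y\in\{1,\dots,C\}$ is the ground-truth class, is weakly order preserving.
   Context: $C$ is the number of classes, $(t)_+=\max\{t,0\}$ and $\Delta^C=\{p\in\mathbb R^C: p_i\ge 0,\ \sum_i p_i=1\}$. A mapping $\hat p:\mathbb R^C\to\Delta^C$ is weakly order preserving (WOP) if for any $i\neq j$, $s_i>s_j\Rightarrow\hat p_i(s)\ge\hat p_j(s)$ holds for all $s$, and moreover there exist $s$ and $i\ne j$ with $s_i>s_j$ and yet $\hat p_i(s)=\hat p_j(s)$.
   Formalization: The number of classes C is assumed to be at least 3; for C = 1 or 2 the Rankmax mapping is not weakly order preserving, since two classes with different scores never receive equal probabilities. *)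

(* Defs.v *)
From mathcomp Require Import all_boot all_order all_algebra.
From mathcomp Require Import reals.

Set Implicit Arguments.
Unset Strict Implicit.
Unset Printing Implicit Defensive.

Import Order.TTheory GRing.Theory Num.Theory.
Local Open Scope ring_scope.

Definition pos_part (R : realType) (t : R) : R := Num.max t 0.

Definition in_simplex (R : realType) (C : nat) (p : 'rV[R]_C) : Prop :=
  (forall i : 'I_C, 0 <= p ord0 i) /\ \sum_(i < C) p ord0 i = 1.

(* The first clause says that [p] is a mapping from R^C to the simplex; the
   last one says that the order is not always preserved strictly. *)
Definition weakly_order_preserving (R : realType) (C : nat)
    (p : 'rV[R]_C -> 'rV[R]_C) : Prop :=
  [/\ forall s : 'rV[R]_C, in_simplex (p s),
      forall (s : 'rV[R]_C) (i j : 'I_C),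
        i <> j -> s ord0 i > s ord0 j -> p s ord0 i >= p s ord0 j
    & exists (s : 'rV[R]_C) (i j : 'I_C),
        [/\ i <> j, s ord0 i > s ord0 j & p s ord0 i = p s ord0 j]].

(* The denominator is positive, since its term of index [y] is 1. For C <= 2 no
   tie with distinct scores occurs: if C = 2 and k <> y, equal entries force
   s_k - s_y + 1 = 1. Ties need two classes other than [y], i.e. C >= 3. *)
Definition rankmax (R : realType) (C : nat) (y : 'I_C) (s : 'rV[R]_C) :
    'rV[R]_C :=
  \row_(i < C) (pos_part (s ord0 i - s ord0 y + 1) /
                \sum_(j < C) pos_part (s ord0 j - s ord0 y + 1)).

(* Main.v *)
Require Import Defs.
From mathcomp Require Import all_boot all_order all_algebra.
From mathcomp Require Import reals.

Import Order.TTheory GRing.Theory Num.Theory.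
Local Open Scope ring_scope.

(** All entries share one positive denominator ([rankmax_denom_gt0]), so they are ordered like their
    numerators, which are nondecreasing in the score ([le_rankmax]). Strictness is lost by
    truncation: every class scoring at least 1 below [y] gets exactly 0 ([rankmax_eq0]), so two such
    classes tie even when their scores differ. *)

Lemma pos_part_ge0 (R : realType) (t : R) : 0 <= pos_part t.
Proof. by rewrite /pos_part le_max lexx orbT. Qed.

Lemma pos_part_eq0 (R : realType) (t : R) : t <= 0 -> pos_part t = 0.
Proof. exact: max_r. Qed.

Lemma le_pos_part (R : realType) (t u : R) :
  t <= u -> pos_part t <= pos_part u.
Proof. by move=> le_tu; rewrite /pos_part ge_max !le_max le_tu lexx orbT. Qed.

(** This rules out division by zero, whose default value 0 would keep the entries from summing to
    1. *)
Lemma rankmax_denom_gt0 (R : realType) (C : nat) (y : 'I_C) (s : 'rV[R]_C) :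
  0 < \sum_(j < C) pos_part (s ord0 j - s ord0 y + 1).
Proof.
rewrite (bigD1 y) //= subrr add0r ltr_pwDl //.
  by rewrite /pos_part lt_max ltr01.
by apply: sumr_ge0 => j _; exact: pos_part_ge0.
Qed.

Lemma rankmax_in_simplex (R : realType) (C : nat) (y : 'I_C) (s : 'rV[R]_C) :
  in_simplex (rankmax y s).
Proof.
split=> [i|]; first by rewrite mxE divr_ge0 ?pos_part_ge0 ?ltW ?rankmax_denom_gt0.
under eq_bigr do rewrite mxE.
by rewrite -mulr_suml divff // gt_eqF ?rankmax_denom_gt0.
Qed.

Lemma le_rankmax (R : realType) (C : nat) (y : 'I_C) (s : 'rV[R]_C)
    (i j : 'I_C) :
  s ord0 j <= s ord0 i -> rankmax y s ord0 j <= rankmax y s ord0 i.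
Proof.
move=> le_ji; rewrite !mxE ler_pM2r ?invr_gt0 ?rankmax_denom_gt0 //.
by apply: le_pos_part; rewrite !lerD2r.
Qed.

Lemma rankmax_eq0 (R : realType) (C : nat) (y : 'I_C) (s : 'rV[R]_C)
    (i : 'I_C) :
  s ord0 i + 1 <= s ord0 y -> rankmax y s ord0 i = 0.
Proof.
by move=> le_iy; rewrite mxE pos_part_eq0 ?mul0r // addrAC subr_le0.
Qed.

Theorem propositionB4 (R : realType) (C : nat) (hC : (3 <= C)%N) (y : 'I_C) :
  weakly_order_preserving (@rankmax R C y).
Proof.
split=> [s|s i j _ /ltW|]; [exact: rankmax_in_simplex|exact: le_rankmax|].
(* Since [3 <= C], at least two classes differ from [y]; they will carry the tie. *)
have /card_gt1P[i [j [neq_iy neq_jy neq_ij]]] : (1 < #|predC1 y|)%N.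
  by rewrite cardC1 card_ord; case: C hC {y} => [|[|[|]]].
rewrite !inE in neq_iy neq_jy.
(* Both scores lie at least 1 below that of [y], so both entries vanish. *)
pose s : 'rV[R]_C := \row_k (if k == i then -1 else if k == j then - 2 else 0).
have si : s ord0 i = -1 by rewrite mxE eqxx.
have sj : s ord0 j = - 2 by rewrite mxE eq_sym (negPf neq_ij) eqxx.
have sy : s ord0 y = 0.
  by rewrite mxE ![y == _]eq_sym (negPf neq_iy) (negPf neq_jy).
have lt_ji : s ord0 j < s ord0 i by rewrite si sj ltrN2 ltr1n.
have le_iy : s ord0 i + 1 <= s ord0 y by rewrite si sy addNr.
exists s, i, j; split=> //; first exact/eqP.
rewrite !rankmax_eq0 //.
(* The bound for [j] is inherited from [i], since [j] scores lower. *)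
by apply: le_trans le_iy; rewrite lerD2r ltW.
Qed.
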